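(* Let $n=18k+1$ where $k$ is an even positive integer. Then there exists a decomposition $[\mathsf{K}^c_n,P]$ of the complete convex geometric graph $\mathsf{K}^c_n$ such that each member of $P$ is a triangle and \[\chi'([\mathsf{K}^c_n,P])\leq \frac{n^{2}}{36}+\Theta(n).\]
   Context: $\mathsf{K}^c_n$ denotes the complete geometric graph whose $n$ vertices are points in convex position (the vertices of a convex polygon, e.g. a regular $n$-gon) and whose edges are all $\binom n2$ straight-line segments between them. A decomposition $[G,P]$ of a graph $G$ is a set $P$ of non-empty induced subgraphs of $G$ such that every edge of $G$ belongs to exactly one member of $P$; a triangle is a complete subgraph on $3$ vertices. Two geometric graphs have nonempty intersection if they share a vertex or some edge of one crosses some edge of the other. A $k$-$P$-coloring assigns to each edge one of $k$ colors so that all edges of each member of $P$ get the same color and any two members of $P$ with nonempty intersection get different colors; the chromatic index $\chi'([\mathsf{K}^c_n,P])$ is the least such $k$. *)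

(* Defs.v *)
From HB Require Import structures.
From mathcomp Require Import all_boot all_order all_algebra.
From mathcomp Require Import all_classical all_reals all_analysis.
Set Implicit Arguments.
Unset Strict Implicit.
Unset Printing Implicit Defensive.
Import Order.TTheory GRing.Theory Num.Theory.
Import numFieldNormedType.Exports.
Local Open Scope classical_set_scope.
Local Open Scope ring_scope.

Definition plane (R : realType) := 'rV[R]_2.

(* No point lies in the convex hull of the others; in particular [p] is
   injective and no three of the points are collinear. *)
Definition convex_position (R : realType) (T : Type) (p : T -> plane R) : Prop :=
  forall i : T,
    ~ smallest (@convex_set R (plane R)) [set p j | j in [set j | j <> i]] (p i).

Definition open_segment (R : realType) (a b : plane R) : set (plane R) :=
  [set (1 - t) *: a + t *: b | t in [set t : R | 0 < t < 1]].

Section GeometricGraph.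

(* A geometric graph: a simple graph [adj] on [T], drawn with straight-line edges
   between the points [p x]. An induced subgraph is given by its vertex set. *)
Variables (R : realType) (T : finType) (adj : rel T) (p : T -> plane R).
Implicit Types (S : {set T}) (P : {set {set T}}).

Definition edge_of S (x y : T) : bool := [&& x \in S, y \in S & adj x y].

Definition is_decomposition P : Prop :=
  (forall S, S \in P -> S != finset.set0) /\
  (forall x y : T, adj x y -> exists! S, S \in P /\ edge_of S x y).

Definition is_triangle S : Prop :=
  #|S| = 3%N /\ (forall x y : T, x \in S -> y \in S -> x != y -> adj x y).

Definition edges_cross (x y u v : T) : Prop :=
  open_segment (p x) (p y) `&` open_segment (p u) (p v) !=set0.

Definition intersecting S1 S2 : Prop :=
  (exists x : T, x \in S1 /\ x \in S2) \/
  (exists x y u v : T,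
     [/\ edge_of S1 x y, edge_of S2 u v & edges_cross x y u v]).

(* The edge xy is the two-element set {x, y}; values of [c] elsewhere are
   irrelevant. *)
Definition is_coloring P (k : nat) (c : {set T} -> nat) : Prop :=
  [/\ forall x y : T, adj x y -> (c [set x; y]%SET < k)%N,
      forall S x y u v, S \in P -> edge_of S x y -> edge_of S u v ->
        c [set x; y]%SET = c [set u; v]%SET
    & forall S1 S2 x y u v, S1 \in P -> S2 \in P -> S1 != S2 ->
        intersecting S1 S2 -> edge_of S1 x y -> edge_of S2 u v ->
        c [set x; y]%SET <> c [set u; v]%SET].

Definition colorable P (k : nat) : Prop := exists c, is_coloring P k c.

Definition is_chromatic_index P (k : nat) : Prop :=
  colorable P k /\ (forall m : nat, colorable P m -> (k <= m)%N).

End GeometricGraph.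

Definition complete_rel (T : eqType) : rel T := fun x y => x != y.

(* Main.v *)
(* Write n = 36h + 1. Place the points in cyclic order and identify them with the
   integers modulo n. We take the Steiner triple system formed by the n translates of 6h base
   triangles, chosen so that each difference 1, ..., 18h occurs exactly once. The
   base triangles come in six families indexed by j = 1, ..., h, and for all but
   O(1) values of j one triangle of each family can be rotated so that the six
   are nested, each lying in one arc cut off by the previous one. Six nested
   triangles and their simultaneous rotations use n colors, so n(h + O(1)) =
   n^2/36 + O(n) colors suffice. *)
Require Import Defs.
From HB Require Import structures.
From mathcomp Require Import all_boot all_order all_algebra.
From mathcomp Require Import all_classical all_reals all_analysis.
From mathcomp Require Import zify ring lra.
Set Implicit Arguments.
Unset Strict Implicit.
Unset Printing Implicit Defensive.
Import Order.TTheory GRing.Theory Num.Theory.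
Import numFieldNormedType.Exports.
Local Open Scope classical_set_scope.
Local Open Scope ring_scope.

(** * Base triangles *)

Section BaseTriangles.
Local Open Scope nat_scope.

(* Each class [c < 6], [1 <= j <= h] is a base triangle whose differences [x, y, z]
   modulo [36h + 1] satisfy [x + y = z] or [x + y + z = 36h + 1]:
     c = 0: 5h+2j, 5h+1-j, 10h+1+j       c = 1: 2j, 12h+1-j, 12h+1+j  (j < h)
     c = 2: 2j-1, 14h+1-j, 14h+j         c = 3: 3h+j, 15h+j, 18h+1-2j
     c = 4: 7h+j, 9h+j, 16h+2j           c = 5: 5h+2j-1, 3h+1-j, 8h+j
   and the entry [c = 1], [j = h] uses the three values left over,
   2h, 10h+1 and 12h+1. Together they exhaust [1 .. 18h]. The subtractions in
   [c = 4] are never truncated when [1 <= j <= h]. *)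
Definition base_triple (h c j : nat) : nat * nat * nat :=
  match c with
  | 0 => (0, 5 * h + 2 * j, 31 * h + j)
  | 1 => if j < h then (5 * h + 2 * j + 1, 5 * h + 4 * j + 1, 29 * h + 3 * j + 1)
         else (0, 2 * h, 12 * h + 1)
  | 2 => (5 * h + 4 * j + 2, 5 * h + 6 * j + 1, 27 * h + 5 * j + 2)
  | 3 => (5 * h + 6 * j + 2, 8 * h + 7 * j + 2, 26 * h + 5 * j + 3)
  | 4 => (15 * h - 7 * j - 4, 22 * h - 6 * j - 4, 31 * h - 5 * j - 4)
  | _ => (16 * h + 6 * j + 3, 21 * h + 8 * j + 2, 24 * h + 7 * j + 3)
  end.

Definition vertex (h c j i : nat) : nat :=
  match i with
  | 0 => (base_triple h c j).1.1
  | 1 => (base_triple h c j).1.2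
  | _ => (base_triple h c j).2
  end.

(* For [j <= h - 2], class 4 is matched with the other classes in the reversed
   order [h - 1 - j]; each remaining triangle ([j >= h - 1]) has its own slot. *)
Definition slot (h c j : nat) : nat :=
  if j + 2 <= h then (if c == 4 then h - 1 - j else j) else h + 6 * (h - j) + c.

Lemma vertex_ltn (h c j : nat) : c < 6 -> 0 < j <= h ->
  vertex h c j 0 < vertex h c j 1 < vertex h c j 2 /\
  vertex h c j 2 < 36 * h + 1.
Proof.
case: c => [|[|[|[|[|[|//]]]]]] _ jh; rewrite /vertex /=; try lia.
by case: (ltnP j h) => ? /=; lia.
Qed.

(** At most [j = h - 1] and [j = h] are left unmatched, with six classes each, whence the extra
    12. *)
Lemma slot_ltn (h c j : nat) : c < 6 -> 0 < j <= h -> slot h c j < h + 12.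
Proof. by rewrite /slot; case: ifP => ?; [case: ifP => _|]; lia. Qed.

(** For a fixed class the slot is injective in [j], so distinct triangles in one slot can be ordered
    by class. *)
Lemma slot_nested (h c j c' j' : nat) : c < 6 -> c' < 6 ->
  0 < j <= h -> 0 < j' <= h -> slot h c j = slot h c' j' ->
  c < c' \/ (c = c' /\ j = j') \/ c' < c.
Proof.
case: (ltngtP c c') => [|| <-]; [by left|by right; right|] => c6 _ jh j'h.
rewrite /slot; case: (leqP (j + 2) h) => ?; case: (leqP (j' + 2) h) => ?;
  case: (c == 4) => ?; right; left; lia.
Qed.

(** The triangle of the later class fits into the arc between the second and third vertices of the
    earlier one; the rotations in [base_triple] are chosen for this. *)
Lemma slot_eq_nested (h c j c' j' : nat) : c < c' -> c' < 6 ->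
  0 < j <= h -> 0 < j' <= h -> slot h c j = slot h c' j' ->
  vertex h c j 1 < vertex h c' j' 0 /\ vertex h c' j' 2 < vertex h c j 2.
Proof.
rewrite /slot => cc' c'6 jh j'h eqs.
(* A slot from [h] on determines the class of its triangle, so both triangles are matched ones. *)
have [jh2 j'h2] : j + 2 <= h /\ j' + 2 <= h.
  by move: eqs; case: (leqP (j + 2) h) => ?; case: (leqP (j' + 2) h) => ?;
    case: (c == 4); case: (c' == 4); lia.
have jlt : j < h by lia.
have j'lt : j' < h by lia.
rewrite jh2 j'h2 in eqs.
by move: c c' cc' c'6 eqs => [|[|[|[|[|[|c]]]]]] [|[|[|[|[|[|c']]]]]] //= _ _;
  rewrite /vertex /= ?jlt ?j'lt /=; lia.
Qed.

(** The second alternative is a side that wraps around modulo 36h + 1. The cases on [d] run through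
    the table of differences in increasing order, split by parity where two columns interleave. *)
Lemma small_difference (h d : nat) : 0 < d <= 18 * h ->
  exists c j i k, [/\ c < 6, 0 < j <= h, i != k, i < 3 /\ k < 3 &
    vertex h c j k = vertex h c j i + d \/
    vertex h c j k + (36 * h + 1) = vertex h c j i + d].
Proof.
pose ex c j i k := [/\ c < 6, 0 < j <= h, i != k, i < 3 /\ k < 3 &
    vertex h c j k = vertex h c j i + d \/
    vertex h c j k + (36 * h + 1) = vertex h c j i + d].
have use c j i k : ex c j i k -> exists c j i k, ex c j i k by exists c, j, i, k.
(* Class 1 follows its general formula only for [j < h]; the three leftover values use [j = h]
   directly. *)
have B j i k : 0 < j < h ->
  let v i := match i with 0 => 5 * h + 2 * j + 1 | 1 => 5 * h + 4 * j + 1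
             | _ => 29 * h + 3 * j + 1 end in
  i < 3 -> k < 3 -> i != k ->
  v k = v i + d \/ v k + (36 * h + 1) = v i + d -> ex 1 j i k.
  move=> jh v i3 k3 ik E; split => //; first lia.
  by rewrite /vertex /= ifT //; lia.
move=> dh; apply: (@id (exists c j i k, ex c j i k)).
have [d1|d1] := leqP d (2 * h).
  case: (boolP (odd d)) => od.
    by apply: (use 2 d.+1./2 0 1); split; rewrite /vertex /=; lia.
  have [dd|dd] := ltnP d (2 * h).
    by apply: (use 1 d./2 0 1); apply: B; lia.
  by apply: (use 1 h 0 1); split; rewrite /vertex /= ?ltnn /=; lia.
have [d2|d2] := leqP d (3 * h).
  by apply: (use 5 (3 * h + 1 - d) 1 2); split; rewrite /vertex /=; lia.
have [d3|d3] := leqP d (4 * h).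
  by apply: (use 3 (d - 3 * h) 0 1); split; rewrite /vertex /=; lia.
have [d4|d4] := leqP d (5 * h).
  by apply: (use 0 (5 * h + 1 - d) 2 0); split; rewrite /vertex /=; lia.
have [d5|d5] := leqP d (7 * h).
  case: (boolP (odd (d - 5 * h))) => od.
    by apply: (use 5 (d - 5 * h).+1./2 0 1); split; rewrite /vertex /=; lia.
  by apply: (use 0 (d - 5 * h)./2 0 1); split; rewrite /vertex /=; lia.
have [d6|d6] := leqP d (8 * h).
  by apply: (use 4 (d - 7 * h) 0 1); split; rewrite /vertex /=; lia.
have [d7|d7] := leqP d (9 * h).
  by apply: (use 5 (d - 8 * h) 0 2); split; rewrite /vertex /=; lia.
have [d8|d8] := leqP d (10 * h).
  by apply: (use 4 (d - 9 * h) 1 2); split; rewrite /vertex /=; lia.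
have [d9|d9] := leqP d (10 * h + 1).
  by apply: (use 1 h 1 2); split; rewrite /vertex /= ?ltnn /=; lia.
have [d10|d10] := leqP d (11 * h + 1).
  by apply: (use 0 (d - 10 * h - 1) 2 1); split; rewrite /vertex /=; lia.
have [d11|d11] := leqP d (12 * h).
  by apply: (use 1 (12 * h + 1 - d) 2 0); apply: B; lia.
have [d12|d12] := leqP d (12 * h + 1).
  by apply: (use 1 h 0 2); split; rewrite /vertex /= ?ltnn /=; lia.
have [d13|d13] := leqP d (13 * h).
  by apply: (use 1 (d - 12 * h - 1) 2 1); apply: B; lia.
have [d14|d14] := leqP d (14 * h).
  by apply: (use 2 (14 * h + 1 - d) 2 0); split; rewrite /vertex /=; lia.
have [d15|d15] := leqP d (15 * h).
  by apply: (use 2 (d - 14 * h) 2 1); split; rewrite /vertex /=; lia.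
have [d16|d16] := leqP d (16 * h).
  by apply: (use 3 (d - 15 * h) 2 0); split; rewrite /vertex /=; lia.
case: (boolP (odd d)) => od.
  by apply: (use 3 (18 * h + 1 - d)./2 1 2); split; rewrite /vertex /=; lia.
by apply: (use 4 (d - 16 * h)./2 0 2); split; rewrite /vertex /=; lia.
Qed.

End BaseTriangles.

(** * Points in convex position *)

Section Orientation.
Variable R : realType.
Implicit Types a b c d : plane R.

Definition px a : R := a ord0 ord0.
Definition py a : R := a ord0 ord_max.

Lemma planeP a b : px a = px b -> py a = py b -> a = b.
Proof.
rewrite /px /py => hx hy; apply/rowP => i.
by case: i => [[|[|//]] Hi]; [rewrite (_ : Ordinal Hi = ord0)|rewrite (_ : Ordinal Hi = ord_max)];
  rewrite //; apply: val_inj.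
Qed.

Lemma pxD a b : px (a + b) = px a + px b. Proof. by rewrite /px mxE. Qed.
Lemma pyD a b : py (a + b) = py a + py b. Proof. by rewrite /py mxE. Qed.
Lemma pxZ k a : px (k *: a) = k * px a. Proof. by rewrite /px mxE. Qed.
Lemma pyZ k a : py (k *: a) = k * py a. Proof. by rewrite /py mxE. Qed.
Definition coordE := (pxD, pyD, pxZ, pyZ).

(** Twice the signed area of the triangle, positive when it is counterclockwise. *)
Definition orient a b c : R :=
  (px b - px a) * (py c - py a) - (py b - py a) * (px c - px a).

Lemma orient_rot a b c : orient b c a = orient a b c.
Proof. by rewrite /orient; ring. Qed.

Lemma orient_swap a b c : orient b a c = - orient a b c.
Proof. by rewrite /orient; ring. Qed.

Lemma orient_comb a b c d t :
  orient a b ((1 - t) *: c + t *: d) = (1 - t) * orient a b c + t * orient a b d.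
Proof. by rewrite /orient !coordE; ring. Qed.

Lemma orient_open_segment a b x : open_segment a b x -> orient a b x = 0.
Proof. by case=> t _ <-; rewrite /orient !coordE; ring. Qed.

(** [orient a b] is affine, so it keeps a strict sign between [c] and [d], but it vanishes on the
    segment from [a] to [b]. *)
Lemma open_segments_disjoint a b c d :
  0 < orient a b c * orient a b d ->
  ~ (open_segment a b `&` open_segment c d !=set0).
Proof.
move=> cd0 [x [/orient_open_segment ab [t /= /andP[t0 t1] cd]]].
move: ab cd0; rewrite -cd orient_comb.
set A := orient a b c; set B := orient a b d => ab AB.
have : A * ((1 - t) * A + t * B) = 0 by rewrite ab mulr0.
have : 0 <= (1 - t) * A ^+ 2 by rewrite mulr_ge0 ?sqr_ge0 // subr_ge0 ltW.
have : 0 < t * (A * B) by rewrite mulr_gt0.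
lra.
Qed.

End Orientation.

(** * Orientations of points in convex position *)

Section ConvexPosition.
Variables (R : realType) (T : eqType) (p : T -> plane R).
Hypothesis convp : convex_position p.

Let hull (i : T) := smallest (@convex_set R (plane R)) [set p j | j in [set j | j <> i]].

Lemma hull_point i j : j != i -> hull i (p j).
Proof. by move=> /eqP ji; apply: sub_gen_smallest; exists j. Qed.

Lemma hull_comb i x y (s t : R) : 0 <= s -> 0 <= t -> s + t = 1 ->
  hull i x -> hull i y -> hull i (s *: x + t *: y).
Proof.
move=> s0 t0 st hx hy C CC.
have xC := hx C CC; have yC := hy C CC.
have s1 : s <= 1 by lra.
pose l := @Itv01 R s s0 s1.
have := CC.1 x y l; rewrite !inE => /(_ xC yC).
suff <- : conv l (x : convex_lmodType (plane R)) y = s *: x + t *: y by [].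
by rewrite -(_ : 1 - s = t) //; lra.
Qed.

(** The form in which convex position is contradicted below: weights are not normalized, so
    orientations can serve as weights, and points may repeat. *)
Lemma convex_position_comb i a b c (r s t : R) :
  a != i -> b != i -> c != i -> 0 <= r -> 0 <= s -> 0 <= t -> 0 < r + s + t ->
  r * px (p a) + s * px (p b) + t * px (p c) = (r + s + t) * px (p i) ->
  r * py (p a) + s * py (p b) + t * py (p c) = (r + s + t) * py (p i) -> False.
Proof.
move=> ai bi ci r0 s0 t0 rst0 hx hy.
have /convp[] : hull i (p i).
have k0 : r + s + t != 0 by rewrite gt_eqF.
have [rs0|rs0] := eqVneq (r + s) 0.
  have [r00 s00] : r = 0 /\ s = 0 by split; apply/eqP; rewrite eq_le; apply/andP; split; lra.
  have -> : p i = p c; last exact: hull_point.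
  have t1 : t != 0 by rewrite r00 s00 !add0r in k0.
  by move: hx hy; rewrite r00 s00 !mul0r !add0r => hx hy; apply: planeP; apply: (mulfI t1).
have rs1 : 0 < r + s by rewrite lt_neqAle eq_sym rs0 addr_ge0.
have -> : p i = ((r + s) / (r + s + t)) *:
    ((r / (r + s)) *: p a + (s / (r + s)) *: p b) + (t / (r + s + t)) *: p c.
  by apply: planeP; rewrite !coordE; apply: (mulfI k0); [rewrite -hx|rewrite -hy];
    field; rewrite k0 rs0.
apply: hull_comb; last exact: hull_point.
- by rewrite divr_ge0 // ltW.
- by rewrite divr_ge0 // ltW.
- by field; rewrite k0.
apply: hull_comb; try exact: hull_point.
- by rewrite divr_ge0 // ltW.
- by rewrite divr_ge0 // ltW.
- by field; rewrite rs0.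
Qed.

Lemma orient_neq0 a b c : a != b -> a != c -> b != c ->
  orient (p a) (p b) (p c) != 0.
Proof.
move=> ab ac bc; apply/eqP; rewrite /orient.
set u := px (p b) - px (p a); set u' := py (p b) - py (p a).
set v := px (p c) - px (p a); set v' := py (p c) - py (p a) => o0.
(* Collinearity gives m (c - a) = s (b - a), so s/m locates [c] on the line with [a] at 0 and [b] at
   1; its position tells which point lies between the other two. *)
pose m := u ^+ 2 + u' ^+ 2; pose s := u * v + u' * v'.
have ba : b != a by rewrite eq_sym.
have ca : c != a by rewrite eq_sym.
have cb : c != b by rewrite eq_sym.
have m0 : 0 < m.
  rewrite lt_neqAle addr_ge0 ?sqr_ge0 // andbT eq_sym.
  rewrite paddr_eq0 ?sqr_ge0 // !sqrf_eq0; apply/negP => /andP[/eqP u0 /eqP u'0].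
  by apply: (@convex_position_comb a b b b 1 0 0) => //; rewrite /u /u' in u0 u'0; lra.
have hx : m * v = s * u.
  apply/eqP; rewrite -subr_eq0 (_ : _ - _ = - u' * (u * v' - u' * v)).
    by rewrite o0 mulr0.
  by rewrite /m /s; ring.
have hy : m * v' = s * u'.
  apply/eqP; rewrite -subr_eq0 (_ : _ - _ = u * (u * v' - u' * v)).
    by rewrite o0 mulr0.
  by rewrite /m /s; ring.
have [s0|s0] := lerP s 0.
  apply: (@convex_position_comb a c b b m (- s) 0) => //; rewrite /u /u' /v /v' in hx hy; lra.
have [sm|sm] := lerP s m.
  apply: (@convex_position_comb c b a a s (m - s) 0) => //; rewrite /u /u' /v /v' in hx hy; lra.
apply: (@convex_position_comb b c a a m (s - m) 0) => //; rewrite /u /u' /v /v' in hx hy; lra.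
Qed.

(** Otherwise [o] is a convex combination of [i], [j], [k], with the areas of the triangles at [o]
    as barycentric weights. *)
Lemma orient_trans o i j k : o != i -> o != j -> o != k -> i != k ->
  0 < orient (p o) (p i) (p j) -> 0 < orient (p o) (p j) (p k) ->
  0 < orient (p o) (p i) (p k).
Proof.
move=> oi oj ok ik; rewrite ltNge => h1 h2; rewrite ltNge; apply/negP => h3.
apply: (@convex_position_comb o i j k (orient (p o) (p j) (p k))
  (- orient (p o) (p i) (p k)) (orient (p o) (p i) (p j))).
all: try by rewrite eq_sym.
all: try (by rewrite /orient; ring); lra.
Qed.

(** Otherwise [j] is a convex combination of [i], [k] and [o]. *)
Lemma orient_fan o i j k : o != i -> o != j -> o != k ->
  i != j -> j != k -> i != k ->
  0 < orient (p o) (p i) (p j) -> 0 < orient (p o) (p j) (p k) ->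
  0 < orient (p i) (p j) (p k).
Proof.
move=> oi oj ok ij jk ik h1 h2; have h3 := orient_trans oi oj ok ik h1 h2.
rewrite ltNge; apply/negP => h4.
apply: (@convex_position_comb j i k o (orient (p o) (p j) (p k))
  (orient (p o) (p i) (p j)) (- orient (p i) (p j) (p k))) => //.
all: try by rewrite eq_sym.
all: try (by rewrite /orient; ring); lra.
Qed.

End ConvexPosition.

(* The order is by angle around the point [p ord0]. *)
Lemma convex_position_cyclic_order (R : realType) (n : nat)
    (p : 'I_n.+1 -> plane R) : convex_position p ->
  exists2 s : 'I_n.+1 -> 'I_n.+1, injective s &
    forall i j k : 'I_n.+1, (i < j < k)%N ->
      0 < orient (p (s i)) (p (s j)) (p (s k)).
Proof.
move=> convp; pose o : 'I_n.+1 := ord0.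
(* [o] is made the least element. *)
pose le i j := (i == o) || ((j != o) && ((i == j) || (0 < orient (p o) (p i) (p j)))).
have le_total : total le.
  move=> i j; rewrite /le; have [//|io] := eqVneq i o.
  have [//|jo /=] := eqVneq j o; have [//|ij] := eqVneq i j.
  rewrite /= (_ : orient _ (p j) _ = - orient (p o) (p i) (p j));
    last by rewrite /orient; ring.
  by rewrite oppr_gt0 orbC -neq_lt orient_neq0 // eq_sym.
have le_trans : transitive le.
  move=> j i k; rewrite /le; have [//|io /=] := eqVneq i o.
  have [//|jo /=] := eqVneq j o; have [//|ko /=] := eqVneq k o.
  have [->//|ij /=] := eqVneq i j; have [<-|jk /=] := eqVneq j k.
    by move=> ->; rewrite orbT.
  move=> h1 h2; have [//|ik /=] := eqVneq i k.
  by apply: (orient_trans convp _ _ _ ik h1 h2); rewrite eq_sym.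
pose l := sort le (enum 'I_n.+1).
have sl : size l = n.+1 by rewrite size_sort size_enum_ord.
have ul : uniq l by rewrite sort_uniq enum_uniq.
have lP : sorted le l by exact: sort_sorted.
pose s (i : 'I_n.+1) := nth o l i.
have s_inj : injective s.
  by move=> i j /eqP; rewrite nth_uniq ?sl // => /eqP/val_inj.
have s_lt (i j : 'I_n.+1) : (i < j)%N -> le (s i) (s j).
  by move=> ij; apply: (sorted_ltn_nth le_trans) => //; rewrite inE sl.
exists s => // i j k /andP[ij jk].
have ik := ltn_trans ij jk.
have neq (a b : 'I_n.+1) : (a < b)%N -> s a != s b.
  by move=> ab; rewrite (inj_eq s_inj) -val_eqE neq_ltn ab.
(* Only the first entry of the sorted list can be [o], and neither [j] nor [k] is first. *)
have sjo : s j != o.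
  apply/eqP => sjo; move: (s_lt _ _ ij) (neq _ _ ij); rewrite /le sjo eqxx orbF.
  by move=> ->.
have sko : s k != o.
  apply/eqP => sko; move: (s_lt _ _ jk) (neq _ _ jk); rewrite /le sko eqxx orbF.
  by move=> ->.
have o_lt : 0 < orient (p o) (p (s j)) (p (s k)).
  by move: (s_lt _ _ jk); rewrite /le (negPf sjo) sko (negPf (neq _ _ jk)).
have [sio|sio] := eqVneq (s i) o; first by rewrite sio.
have := s_lt _ _ ij; rewrite /le (negPf sio) sjo (negPf (neq _ _ ij)) /= => h1.
by apply: (orient_fan convp _ _ _ (neq _ _ ij) (neq _ _ jk) (neq _ _ ik) h1 o_lt);
  rewrite eq_sym.
Qed.

(** * Colorings *)

Lemma colorable_by_members (R : realType) (T : finType) (adj : rel T)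
    (p : T -> plane R) (P : {set {set T}}) (k : nat) (col : {set T} -> nat) :
  is_decomposition adj P ->
  (forall S, S \in P -> (col S < k)%N) ->
  (forall S1 S2, S1 \in P -> S2 \in P -> S1 != S2 ->
     intersecting adj p S1 S2 -> col S1 <> col S2) ->
  colorable adj p P k.
Proof.
move=> [_ dec] colk col_neq.
(* An edge lies in a unique member, so the pick returns it; 0 is a default for other sets. *)
pose c (e : {set T}) := if [pick B in P | e \subset B] is Some B then col B else 0%N.
have cE S x y : S \in P -> edge_of adj S x y -> c [set x; y]%SET = col S.
  move=> SP Sxy; have /and3P[xS yS xy] := Sxy; rewrite /c; case: pickP => [S'|/(_ S)].
    rewrite finset.subUset !finset.sub1set => /andP[S'P /andP[xS' yS']].
    have [S0 [_ S0P]] := dec _ _ xy.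
    by rewrite -(S0P S) // (S0P S') //; split=> //; apply/and3P.
  by rewrite SP finset.subUset !finset.sub1set xS yS.
exists c; split.
- move=> x y xy; have [S [[SP Sxy] _]] := dec _ _ xy.
  by rewrite (cE S) // colk.
- by move=> S x y u v SP xy uv; rewrite !(cE S).
- by move=> S1 S2 x y u v S1P S2P S12 S1S2 xy uv; rewrite (cE S1) // (cE S2) //; apply: col_neq.
Qed.

Lemma chromatic_index_le (R : realType) (T : finType) (adj : rel T)
    (p : T -> plane R) (P : {set {set T}}) (k : nat) :
  colorable adj p P k ->
  exists2 chi, is_chromatic_index adj p P chi & (chi <= k)%N.
Proof.
move=> /asboolP Pk.
have ex : exists m, `[< colorable adj p P m >] by exists k.
case: (ex_minnP ex) => m /asboolP Pm m_min.
by exists m; [split=> // m' /asboolP/m_min|apply: m_min].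
Qed.

(** * Cyclic order of residues and its invariance under rotation *)

Definition cyclic (a b c : nat) : bool :=
  [|| (a < b < c)%N, (b < c < a)%N | (c < a < b)%N].

Lemma cyclic_add (n : nat) (a b c s : 'I_n.+1) :
  cyclic (a + s)%R (b + s)%R (c + s)%R = cyclic a b c.
Proof.
have addE (i : 'I_n.+1) :
    (i + s)%R = (if i + s < n.+1 then i + s else i + s - n.+1)%N :> nat.
  rewrite /=; case: ltnP => h; first by rewrite modn_small.
  by rewrite -[in LHS](subnK h) modnDr modn_small //; move: (ltn_ord i) (ltn_ord s); lia.
rewrite /cyclic !addE; move: (ltn_ord a) (ltn_ord b) (ltn_ord c) (ltn_ord s).
by case: ifP => ?; case: ifP => ?; case: ifP => ?; lia.
Qed.

(** * The triple system *)

Section Blocks.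
Variable h : nat.
(** One less than the number of points, so that positions form the ring ['I_n.+1]. *)
Local Notation n := (36 * h)%N.

Definition point (t : 'I_6 * 'I_h) (i : 'I_3) : 'I_n.+1 :=
  inord (vertex h t.1 t.2.+1 i).

Lemma vertex_ordered (t : 'I_6 * 'I_h) :
  (vertex h t.1 t.2.+1 0 < vertex h t.1 t.2.+1 1 < vertex h t.1 t.2.+1 2)%N /\
  (vertex h t.1 t.2.+1 2 < n.+1)%N.
Proof. by rewrite -[n.+1]addn1; apply: vertex_ltn; rewrite ?ltn_ord. Qed.

Lemma pointE t i : point t i = vertex h t.1 t.2.+1 i :> nat.
Proof.
rewrite inordK //; have [] := vertex_ordered t.
by case: i => [[|[|[|//]]] ?] /=; lia.
Qed.

Lemma point_inj t : injective (point t).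
Proof.
move=> i j /(congr1 (@nat_of_ord _)); rewrite !pointE => eqij; apply: val_inj.
have [] := vertex_ordered t.
by case: i j eqij => [[|[|[|//]]] ?] [[|[|[|//]]] ?] /=; lia.
Qed.

(** [lift] runs through the two vertices other than [x.2.1], so the domain is the set of ordered
    pairs of distinct vertices of base triangles. *)
Definition difference (x : ('I_6 * 'I_h) * ('I_3 * 'I_2)) : 'I_n.+1 :=
  point x.1 (lift x.2.1 x.2.2) - point x.1 x.2.1.

Lemma point_sub_small (d : 'I_n.+1) : (0 < d <= 18 * h)%N ->
  exists t i k, i != k /\ point t k - point t i = d.
Proof.
move=> /small_difference[c [j [i [k [c6 jh ik [i3 k3] E]]]]].
have j1h : (j.-1 < h)%N by lia.
have [t [tc tj]] : exists t : 'I_6 * 'I_h, (t.1 = c :> nat) /\ t.2.+1 = j.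
  by exists (Ordinal c6, Ordinal j1h) => /=; split => //; lia.
exists t, (Ordinal i3), (Ordinal k3); split => //.
apply/eqP; rewrite subr_eq addrC; apply/eqP/val_inj => /=.
have := ltn_ord (point t (Ordinal k3)).
rewrite !pointE /= tc tj; case: E => E kn.
  by rewrite -E modn_small.
by rewrite -E addn1 modnDr modn_small.
Qed.

Lemma difference_surj (d : 'I_n.+1) : d != 0 -> exists x, difference x = d.
Proof.
have lifted t i k : i != k -> point t k - point t i = d -> exists x, difference x = d.
  by case: (unliftP i k) => [m -> _ <-|->]; [exists (t, (i, m))|rewrite eqxx].
move=> d0; have d_gt0 : (0 < d)%N by rewrite lt0n; apply: contra d0 => /eqP d0; apply/eqP/val_inj.
have [dh|dh] := leqP d (18 * h).
  have [|t [i [k [ik e]]]] := @point_sub_small d; first by rewrite d_gt0.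
  exact: (lifted t i k).
(* A large residue is the opposite of a small one: the same side is read backwards. *)
have [|t [i [k [ik e]]]] := @point_sub_small (- d).
  have dn := ltn_ord d.
  by rewrite /= modn_small; lia.
by apply: (lifted t k i); rewrite 1?eq_sym // -opprB e opprK.
Qed.

(* The [36 h] ordered pairs inside base triangles cover the [36 h] nonzero
   residues, so they do so exactly once. *)
Lemma difference_inj : injective difference.
Proof.
have sub : [set~ 0 : 'I_n.+1]%SET \subset [seq difference x | x in predT].
  apply/fintype.subsetP => d; rewrite finset.in_setC1 => /difference_surj[x <-].
  by apply: fintype.image_f.
have := subset_leq_card sub.
rewrite cardsC1 card_ord /= => ge.
have le := leq_image_card difference predT.
have cardD : #|{: ('I_6 * 'I_h) * ('I_3 * 'I_2)}| = n.
  by rewrite !card_prod !card_ord; lia.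
have /image_injP inj : #|[seq difference x | x in predT]| == #|{: ('I_6 * 'I_h) * ('I_3 * 'I_2)}|.
  by rewrite eqn_leq le cardD.
by move=> x y; apply: inj.
Qed.

Variable s : 'I_n.+1 -> 'I_n.+1.
Hypothesis s_inj : injective s.

(** Rotation by [r] acts on positions around the polygon; [s] turns positions into labels. *)
Definition block (t : 'I_6 * 'I_h) (r : 'I_n.+1) : {set 'I_n.+1} :=
  [set s (point t i + r) | i in 'I_3]%SET.

Lemma card_block t r : #|block t r| = 3%N.
Proof. by rewrite card_imset ?card_ord // => i j /s_inj/addIr/point_inj. Qed.

Lemma block_triangle t r : is_triangle (@complete_rel 'I_n.+1) (block t r).
Proof. by split => //; exact: card_block. Qed.

Definition blocks : {set {set 'I_n.+1}} :=
  [set block x.1 x.2 | x in {: ('I_6 * 'I_h) * 'I_n.+1}]%SET.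

(** The difference of the two positions determines the base triangle and its side, by bijectivity of
    [difference]; the rotation is then forced. *)
Lemma blocks_decomposition : is_decomposition (@complete_rel 'I_n.+1) blocks.
Proof.
split=> [S /imsetP[[t r] _ ->]|x y]; first by rewrite -card_gt0 card_block.
have [s' sK s'K] := injF_bij s_inj.
rewrite /complete_rel -{1}(s'K x) -{1}(s'K y) (inj_eq s_inj) => xy.
have [[t [i m]] e] := difference_surj (d := s' y - s' x) ltac:(by rewrite subr_eq0 eq_sym).
pose r := s' x - point t i.
have pairE t' i' k' r' : x = s (point t' i' + r') -> y = s (point t' k' + r') ->
    s' x = point t' i' + r' /\ s' y - s' x = point t' k' - point t' i'.
  by move=> -> ->; rewrite !sK; split => //; rewrite opprD addrACA subrr addr0.
exists (block t r); split.
  split; first by apply/imsetP; exists (t, r).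
  apply/and3P; split.
  - by apply/imsetP; exists i => //; rewrite /r addrC subrK s'K.
  - apply/imsetP; exists (lift i m) => //.
    have -> : point t (lift i m) + r = difference (t, (i, m)) + s' x.
      by rewrite /r addrCA addrC.
    by rewrite e subrK s'K.
  - by apply: contra xy => /eqP ->.
move=> _ [/imsetP[[t' r'] _ ->] /and3P[/imsetP[i' _ xE] /imsetP[k' _ yE] /eqP nxy]].
have [x'E d'E] := pairE _ _ _ _ xE yE.
have ik' : i' != k' by apply/eqP => ik; apply: nxy; rewrite xE yE ik.
move: d'E; case: (unliftP i' k') ik' => [m' ->|->]; last by rewrite eqxx.
move=> _ d'E; have /difference_inj[tt ii mm] : difference (t, (i, m)) = difference (t', (i', m')).
  by rewrite e d'E.
by rewrite /r tt ii x'E addrC addKr.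
Qed.


(** * Coloring by slot and rotation *)

Definition block_slot (t : 'I_6 * 'I_h) : nat := slot h t.1 t.2.+1.

Variables (R : realType) (p : 'I_n.+1 -> plane R).
Hypothesis s_ccw : forall i j k : 'I_n.+1, (i < j < k)%N ->
  0 < orient (p (s i)) (p (s j)) (p (s k)).

Lemma cyclic_orient (i j k : 'I_n.+1) : cyclic i j k ->
  0 < orient (p (s i)) (p (s j)) (p (s k)).
Proof.
by case/or3P => /s_ccw //; [rewrite orient_rot|rewrite -orient_rot].
Qed.

Lemma intersecting_sym (S1 S2 : {set 'I_n.+1}) :
  intersecting (@complete_rel 'I_n.+1) p S1 S2 ->
  intersecting (@complete_rel 'I_n.+1) p S2 S1.
Proof.
case=> [[x [x1 x2]]|[x [y [u [v [xy uv [z [z1 z2]]]]]]]]; first by left; exists x.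
by right; exists u, v, x, y; split=> //; exists z.
Qed.

(** All of the inner triangle [t'] lies in one arc cut off by each side of [t], hence strictly on
    one side of the line through it. *)
Lemma nested_not_intersecting (t t' : 'I_6 * 'I_h) r :
  (t.1 < t'.1)%N -> block_slot t = block_slot t' ->
  ~ intersecting (@complete_rel 'I_n.+1) p (block t r) (block t' r).
Proof.
move=> tt' slots.
have [in1 in2] := slot_eq_nested tt' (ltn_ord t'.1) (ltn_ord t.2 : 0 < t.2.+1 <= h)%N
  (ltn_ord t'.2 : 0 < t'.2.+1 <= h)%N slots.
have [ord_t _] := vertex_ordered t; have [ord_t' _] := vertex_ordered t'.
have side (i i' : 'I_3) : i != i' ->
    (forall k, cyclic (point t i) (point t i') (point t' k)) \/
    (forall k, cyclic (point t i') (point t i) (point t' k)).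
  move=> ii'; have [ii|ii] : cyclic (point t i) (point t i') (point t' ord0) \/
      cyclic (point t i') (point t i) (point t' ord0).
  + rewrite /cyclic !pointE.
    move: in1 in2 ord_t ord_t'.
    by case: i i' ii' => [[|[|[|//]]] ?] [[|[|[|//]]] ?] //= _; lia.
  + left => k; move: ii in1 in2 ord_t ord_t'; rewrite /cyclic !pointE.
    by case: i i' k ii' => [[|[|[|//]]] ?] [[|[|[|//]]] ?] [[|[|[|//]]] ?] //= _; lia.
  + right => k; move: ii in1 in2 ord_t ord_t'; rewrite /cyclic !pointE.
    by case: i i' k ii' => [[|[|[|//]]] ?] [[|[|[|//]]] ?] [[|[|[|//]]] ?] //= _; lia.
case=> [[x [/imsetP[i _ ->] /imsetP[k _ /s_inj/addIr/(congr1 (@nat_of_ord _))]]]|].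
  rewrite !pointE; move: in1 in2 ord_t ord_t'.
  by case: i k => [[|[|[|//]]] ?] [[|[|[|//]]] ?] //=; lia.
case=> [x [y [u [v [/and3P[/imsetP[i _ ->] /imsetP[i' _ ->] xy]
  /and3P[/imsetP[k _ ->] /imsetP[k' _ ->] uv] cross]]]]].
have ii' : i != i' by apply: contra xy => /eqP ->.
apply: open_segments_disjoint cross.
have [ii|ii] := side _ _ ii'.
  by rewrite mulr_gt0 // cyclic_orient // cyclic_add.
(* Reversing the side flips both signs and keeps the product. *)
rewrite orient_swap [X in _ * X]orient_swap mulrNN.
by rewrite mulr_gt0 // cyclic_orient // cyclic_add.
Qed.

Lemma blocks_colorable :
  colorable (@complete_rel 'I_n.+1) p blocks ((h + 12) * n.+1).
Proof.
(* The color encodes the pair of slot and rotation in base [n.+1], so equal colors leave only nested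
   triangles. *)
pose col (S : {set 'I_n.+1}) :=
  if [pick x : ('I_6 * 'I_h) * 'I_n.+1 | S == block x.1 x.2] is Some x
  then (block_slot x.1 * n.+1 + x.2)%N else 0%N.
have colP S : S \in blocks -> exists t r, S = block t r /\
    col S = (block_slot t * n.+1 + r)%N.
  move=> /imsetP[x _ SE]; rewrite /col; case: pickP => [[t r] /eqP -> /=|/(_ x)].
    by exists t, r.
  by rewrite SE eqxx.
apply: (colorable_by_members (col := col)).
- exact: blocks_decomposition.
- move=> S /colP[t [r [_ ->]]].
  have : (block_slot t < h + 12)%N by apply: slot_ltn; rewrite ltn_ord.
  have := ltn_ord r; move: (block_slot t) (nat_of_ord r) => a b; nia.
move=> S1 S2 /colP[t [r [-> ->]]] /colP[t' [r' [-> ->]]] neq cross eqcol.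
have slots : block_slot t = block_slot t'.
  by have := congr1 (divn^~ n.+1) eqcol; rewrite !divnMDl // !divn_small // !addn0.
have rr : r = r' by apply: val_inj; rewrite slots in eqcol; exact: (addnI eqcol).
rewrite -rr in neq cross.
have [lt|[[e1 e2]|lt]] := slot_nested (ltn_ord t.1) (ltn_ord t'.1)
  (ltn_ord t.2 : 0 < t.2.+1 <= h)%N (ltn_ord t'.2 : 0 < t'.2.+1 <= h)%N slots.
- exact: (nested_not_intersecting lt slots cross).
- case/eqP: neq; congr (block _ _).
  case: t t' e1 e2 {slots cross eqcol} => [a b] [a' b'] /= e1 [e2].
  by rewrite (val_inj e1) (val_inj e2).
- exact: (nested_not_intersecting lt (esym slots) (intersecting_sym cross)).
Qed.

End Blocks.

(** * The quadratic bound *)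

Lemma theta_natr (R : realType) (k : R) : 0 < k ->
  (fun n : nat => k * n%:R) \is 'Theta_\oo (fun n : nat => n%:R : R).
Proof.
move=> k0; rewrite qualifE; apply/asboolP; exists (k, k) => /=; first by rewrite k0.
by apply: nearW => n; rewrite normrM (gtr0_norm k0).
Qed.

Theorem theorem3p2 (R : realType) :
  exists f : nat -> R,
    f \is 'Theta_\oo (fun n : nat => n%:R : R) /\
    forall n k : nat, (0 < k)%N -> ~~ odd k -> n = (18 * k + 1)%N ->
    forall p : 'I_n -> plane R, convex_position p ->
    exists P : {set {set 'I_n}},
      [/\ is_decomposition (@complete_rel 'I_n) P,
          forall S, S \in P -> is_triangle (@complete_rel 'I_n) S
        & exists chi : nat,
            is_chromatic_index (@complete_rel 'I_n) p P chi /\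
            chi%:R <= n%:R ^+ 2 / 36%:R + f n].
Proof.
(* With n = 36h + 1 points, n h is at most n^2/36, and the 12 extra slots cost 12n colors. *)
exists (fun n : nat => 12%:R * n%:R); split; first exact: theta_natr.
move=> n k _ k_even nE; have {k_even} [h kE] : exists h, k = (2 * h)%N.
  by exists k./2; lia.
have {nE k kE}-> : n = (36 * h).+1 by lia.
move=> p /convex_position_cyclic_order[s s_inj s_ccw].
exists (blocks s); split.
- exact: blocks_decomposition.
- by move=> S /imsetP[x _ ->]; exact: block_triangle.
have [chi chiP chi_le] := chromatic_index_le (blocks_colorable s_inj s_ccw).
exists chi; split => //; move: chi_le; rewrite -(ler_nat R) => /le_trans; apply.
have nE : (36 * h).+1%:R = 36%:R * h%:R + 1 :> R by rewrite -natr1 natrM.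
rewrite natrM natrD nE; have := ler0n R h.
by move: (h%:R : R) => x; nra.
Qed.
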